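(* Let $n\ge 1$. For every $m\in\{0,\ldots,2n\}$, \[ \mathrm{ez}_m(z_1,\ldots,z_n)=\sum_{k=\max\{0,m-n\}}^{\lfloor m/2\rfloor}\binom{n-m+2k}{k}\,\mathrm{e}_{m-2k}(z_1,\ldots,z_n). \] For every $m\in\{0,\ldots,n\}$, \begin{align*} \mathrm{ez}_m(z_1,\ldots,z_n)&=\mathrm{oz}_{(1^m)}(z_1,\ldots,z_n),\\ \mathrm{ez}_m(z_1,\ldots,z_n)&=\frac{1}{\prod_{1\le j<k\le n}(z_j-z_k)} \left|\begin{array}{ccc} \mathcal{T}^{\mathrm{monic}}_n(z_1)&\ldots&\mathcal{T}^{\mathrm{monic}}_n(z_n)\\ \vdots&\ddots&\vdots\\ \mathcal{T}^{\mathrm{monic}}_{n-m+1}(z_1)&\ldots&\mathcal{T}^{\mathrm{monic}}_{n-m+1}(z_n)\\ \mathcal{T}^{\mathrm{monic}}_{n-m-1}(z_1)&\ldots&\mathcal{T}^{\mathrm{monic}}_{n-m-1}(z_n)\\ \vdots&\ddots&\vdots\\ \mathcal{T}^{\mathrm{monic}}_0(z_1)&\ldots&\mathcal{T}^{\mathrm{monic}}_0(z_n) \end{array}\right|,\\ \mathrm{ez}_m(z_1,\ldots,z_n)&=\sum_{k=0}^{\lfloor m/2\rfloor}\mathrm{spz}_{(1^{m-2k})}(z_1,\ldots,z_n),\\ \mathrm{e}_m(z_1,\ldots,z_n)&=\sum_{k=0}^{\lfloor m/2\rfloor}(-1)^k\,\tau_{n-m+2k,k}\,\mathrm{ez}_{m-2k}(z_1,\ldots,z_n),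 \end{align*} where $\tau_{s,k}=\dfrac{(s-k-1)!\,s}{k!\,(s-2k)!}$ for integers $s\ge1$, $0\le k\le s/2$, and $\tau_{0,0}=1$. (In the determinant the rows are indexed, in decreasing order, by the degrees $n,n-1,\ldots,0$ with the degree $n-m$ omitted.)
   Context: $z_1,\ldots,z_n$ are independent variables. $\mathcal{T}_m$ are the Chebyshev polynomials of the first kind; $\mathcal{T}^{\mathrm{monic}}_m(u)=2\mathcal{T}_m(u/2)$ for $m>0$ and $\mathcal{T}^{\mathrm{monic}}_0(u)=1$. $(1^q)$ is the partition with $q$ parts equal to $1$ (empty if $q=0$). $\operatorname{Sym}_N$ is the algebra of symmetric polynomials in $N$ variables over $\mathbb{C}$. For $P\in\operatorname{Sym}_{2n}$, $\Phi_n(P)$ is the unique $Q\in\operatorname{Sym}_n$ with $P(x_1,\ldots,x_n,x_1^{-1},\ldots,x_n^{-1})=Q(x_1+x_1^{-1},\ldots,x_n+x_n^{-1})$ (existence and uniqueness hold). A superscript $(N)$ denotes restriction of a symmetric function to $N$ variables. $\mathrm{e}_m$, $\mathrm{h}_m$ are the elementary and complete homogeneous symmetric functions ($\mathrm{e}_0=\mathrm{h}_0=1$, $\mathrm{h}_k=0$ for $k<0$). For a nonempty partition $\lambda$ of length $\ell(\lambda)$, \[ \mathrm{sp}_\lambda=\tfrac12\det\bigl[\mathrm{h}_{\lambda_j-j+k}+\mathrm{h}_{\lambda_j-j-k+2}\bigr]_{j,k=1}^{\ell(\lambda)},\qquad \mathrm{o}_\lambda=\det\bigl[\mathrm{h}_{\lambda_j-j+k}-\mathrm{h}_{\lambda_j-j-k}\bigr]_{j,k=1}^{\ell(\lambda)},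 \] and $\mathrm{sp}_\varnothing=\mathrm{o}_\varnothing=1$. Put $\mathrm{ez}_m=\Phi_n(\mathrm{e}_m^{(2n)})$, $\mathrm{spz}_\lambda=\Phi_n(\mathrm{sp}_\lambda^{(2n)})$, $\mathrm{oz}_\lambda=\Phi_n(\mathrm{o}_\lambda^{(2n)})$. *)

(* Defs.v *)
From HB Require Import structures.
From mathcomp Require Import all_boot all_order all_algebra.
From mathcomp Require Import classical_sets reals complex mpoly.

Set Implicit Arguments.
Unset Strict Implicit.
Unset Printing Implicit Defensive.

Import GRing.Theory.
Local Open Scope ring_scope.

(* Chebyshev polynomials of the first kind. *)
Fixpoint chebT_pair (K : fieldType) (m : nat) : {poly K} * {poly K} :=
  if m is m'.+1 then
    let: (t0, t1) := chebT_pair K m' in (t1, 2%:R *: ('X * t1) - t0)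
  else (1, 'X).

Definition chebT (K : fieldType) (m : nat) : {poly K} := (chebT_pair K m).1.

Definition chebT_monic (K : fieldType) (m : nat) : {poly K} :=
  if m == 0%N then 1 else 2%:R *: (chebT K m \Po (2%:R^-1 *: 'X)).

(* Complete homogeneous symmetric polynomial; the degree is an integer, and
   the value is 0 in negative degree. *)
Definition hsym (K : fieldType) (N : nat) (d : int) : {mpoly K[N]} :=
  if d is Posz k then \sum_(a : 'X_{1..N < k.+1} | mdeg a == k) 'X_[a] else 0.

(* The N-variable symplectic and orthogonal characters of a partition, given
   as its list of parts.  The row and column indices i, j of the determinants
   start from 0, whence the shifts with respect to the usual 1-based
   Jacobi-Trudi formulas
     h_(la_j - j + k) + h_(la_j - j - k + 2),
     h_(la_j - j + k) - h_(la_j - j - k).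
   The empty partition is singled out in [spsym] because of the factor 1/2;
   in [osym] the determinant of a 0 x 0 matrix is already 1. *)
Definition spsym (K : fieldType) (N : nat) (la : seq nat) : {mpoly K[N]} :=
  if la is [::] then 1 else
  2%:R^-1 *:
    \det (\matrix_(i < size la, j < size la)
            (hsym K N ((nth 0%N la i)%:Z - i%:Z + j%:Z)
             + hsym K N ((nth 0%N la i)%:Z - i%:Z - j%:Z))).

Definition osym (K : fieldType) (N : nat) (la : seq nat) : {mpoly K[N]} :=
  \det (\matrix_(i < size la, j < size la)
          (hsym K N ((nth 0%N la i)%:Z - i%:Z + j%:Z)
           - hsym K N ((nth 0%N la i)%:Z - i%:Z - j%:Z - 2%:Z))).

(* Substitution of elements of the field of rational functions K(x_1,...,x_n)
   for the variables of a polynomial in N variables. *)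
Definition rsubst (K : fieldType) (n N : nat)
    (v : 'I_N -> {fraction {mpoly K[n]}}) (P : {mpoly K[N]}) :
    {fraction {mpoly K[n]}} :=
  mmap (fun c : K => tofrac (c%:MP : {mpoly K[n]})) v P.

Definition ratX (K : fieldType) (n : nat) (i : 'I_n) : {fraction {mpoly K[n]}} :=
  tofrac ('X_i : {mpoly K[n]}).

(* (x_1, ..., x_n, x_1^-1, ..., x_n^-1) *)
Definition recip_vars (K : fieldType) (n : nat) (i : 'I_(n + n)) :
    {fraction {mpoly K[n]}} :=
  match split i with
  | inl j => ratX K j
  | inr j => (ratX K j)^-1
  end.

Definition is_Phi (K : fieldType) (n : nat)
    (P : {mpoly K[n + n]}) (Q : {mpoly K[n]}) : Prop :=
  Q \is symmetric /\
  rsubst (@recip_vars K n) P = rsubst (fun i => ratX K i + (ratX K i)^-1) Q.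

(* The Q such that [is_Phi P Q]; it exists and is unique for P symmetric.
   The default value 0 is only taken if there is no such Q. *)
Definition Phi (K : fieldType) (n : nat) (P : {mpoly K[n + n]}) : {mpoly K[n]} :=
  xget 0 (fun Q => is_Phi P Q).

Definition ez (K : fieldType) (n m : nat) : {mpoly K[n]} :=
  Phi (mesym (n + n) K m).

Definition spz (K : fieldType) (n : nat) (la : seq nat) : {mpoly K[n]} :=
  Phi (spsym K (n + n) la).

Definition oz (K : fieldType) (n : nat) (la : seq nat) : {mpoly K[n]} :=
  Phi (osym K (n + n) la).

(* Only meaningful for k <= s/2; tau 0 0 = 1. *)
Definition tau (K : fieldType) (s k : nat) : K :=
  if s == 0%N then 1
  else ((s - k - 1)`! * s)%N%:R / (k`! * (s - 2 * k)`!)%N%:R.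

(* The n x n matrix whose rows are the monic Chebyshev polynomials of degrees
   d = n, n-1, ..., 0, d <> n - m, evaluated at z_1, ..., z_n. *)
Definition cheb_mx (K : fieldType) (n m : nat) : 'M[{mpoly K[n]}]_n :=
  \matrix_(i < n, j < n)
    horner_alg ('X_j : {mpoly K[n]})
      (chebT_monic K (if (i < m)%N then n - i else n - i - 1)%N).

Definition vandermonde_prod (K : fieldType) (n : nat) : {mpoly K[n]} :=
  \prod_(j < n) \prod_(k < n | (j < k)%N) ('X_j - 'X_k).

(* Main.v *)
Require Import Defs.
From HB Require Import structures.
From mathcomp Require Import all_boot all_order all_algebra.
From mathcomp Require Import classical_sets reals complex mpoly.
From mathcomp Require Import perm ring zify.

Set Implicit Arguments.
Unset Strict Implicit.
Unset Printing Implicit Defensive.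

Import Order.Theory GRing.Theory Num.Theory.
Local Open Scope ring_scope.

(** Write z_i = x_i + 1/x_i.  The three identities that do not involve characters
    come from two expansions of products over the variables.

    The first is
      prod_i (1 + x_i t) (1 + t / x_i) = prod_i ((1 + t^2) + z_i t)
                                       = sum_j e_j(z) t^j (1 + t^2)^(n-j).
    The coefficient of t^m on the left is e_m of the 2n variables x_i, 1/x_i, so
    comparing coefficients gives the formula for ez_m ([is_Phi_mesym]).  Reading
    this as an evaluation of Phi requires that a polynomial in the z_i be
    determined by its value at the x_i + 1/x_i ([rsubst_recip_sum_inj]): after
    multiplication by a power of x_1 ... x_n, distinct monomials in the z_i
    acquire distinct leading monomials in the x_i.

    The second is, with u a new variable and T_k the monic Chebyshev polynomials,
      prod_j (u - z_j) = sum_m (-1)^m ez_m T_(n-m)(u)        ([prod_subX_chebT]).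
    It follows from the expansion of the left side in powers of u and from
    u^s = sum_k 'C(s, k) T_(s-2k)(u); substituting the latter into the former
    produces exactly the binomial sums found for ez_m.  Two consequences:
    - expanding T_s back in powers of u, with coefficients (-1)^k tau(s, k), and
      comparing coefficients of powers of u expresses e_m in terms of the ez
      ([mesym_sum_ez]);
    - the determinant of T_(n-i)(y_j) at the n + 1 points u, z_1, ..., z_n is a
      Vandermonde product, equal to prod_j (u - z_j) times the Vandermonde product
      of the z_j.  Expanding it along the column of u, the coefficient of
      T_(n-m)(u) is, up to sign, the minor with the degree n - m omitted, and the
      expansion above identifies it with ez_m times the Vandermonde product
      ([vandermonde_ez]).

    The statements on characters hold before Phi is applied, as identities between
    symmetric polynomials: o_(1^m) = e_m and sp_(1^m) = e_m - e_(m-2).  For a column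
    the determinants that define them are of Hessenberg type, and expanding along
    the first column turns them into the alternating sums of the products
    e_i h_(d-i) ([det_hessenberg]).  The sum of the symplectic characters then
    telescopes. *)

(** * Uniqueness in the definition of [Phi] *)

Lemma mpolyX_neq0 (R : nzRingType) (n : nat) (a : 'X_{1..n}) :
  'X_[a] != 0 :> {mpoly R[n]}.
Proof. by rewrite -mleadc_eq0 mleadXm mcoeffX eqxx oner_neq0. Qed.

Section RationalSubstitution.
Variables (K : fieldType) (n N : nat) (v : 'I_N -> {fraction {mpoly K[n]}}).

(** The scalar part of [rsubst], packaged as a composite of ring morphisms so that
    [rsubst] inherits the ring morphism structure of [mmap]. *)
Definition frac_const : K -> {fraction {mpoly K[n]}} :=
  @tofrac {mpoly K[n]} \o @mpolyC n K.
HB.instance Definition _ := GRing.RMorphism.on frac_const.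
HB.instance Definition _ :=
  GRing.RMorphism.copy (rsubst v) (mmap frac_const v).

Lemma rsubstX i : rsubst v 'X_i = v i.
Proof. by rewrite /rsubst (mmapX v frac_const) mmap1U. Qed.

Lemma rsubst_mesym k :
  rsubst v (mesym N K k) = \sum_(h : {set 'I_N} | #|h| == k) \prod_(i in h) v i.
Proof.
rewrite /mesym rmorph_sum; apply: eq_bigr => h _.
by rewrite rmorph_prod; apply: eq_bigr => i _; exact: rsubstX.
Qed.

End RationalSubstitution.

Section ReciprocalSums.
Variables (K : fieldType) (n : nat).

Definition recip_sum (i : 'I_n) : {fraction {mpoly K[n]}} := ratX K i + (ratX K i)^-1.

(** The image of the monomial a under the substitution of x_i + 1/x_i, multiplied
    by the D-th power of every x_i.  It has this meaning only when D bounds the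
    exponents of a, because of the truncated subtraction. *)
Definition cleared_monomial (D : nat) (a : 'X_{1..n}) : {mpoly K[n]} :=
  \prod_(i < n) (('X_i ^+ 2 + 1) ^+ a i * 'X_i ^+ (D - a i)).

Lemma ratX_neq0 i : ratX K i != 0 :> {fraction {mpoly K[n]}}.
Proof. by rewrite /ratX tofrac_eq0 mpolyX_neq0. Qed.

Lemma cleared_monomialE D a : (mdeg a <= D)%N ->
  tofrac (cleared_monomial D a) =
  \prod_(i < n) ratX K i ^+ D * \prod_(i < n) recip_sum i ^+ a i.
Proof.
move=> le_aD; rewrite /cleared_monomial rmorph_prod -big_split.
apply: eq_bigr => i _ /=; rewrite rmorphM !rmorphXn rmorphD rmorphXn rmorph1.
rewrite -/(ratX K i).
have leaD : (a i <= D)%N.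
  by apply: leq_trans le_aD; rewrite mdegE (bigD1 i) //= leq_addr.
rewrite -{2}(subnK leaD) exprD mulrC -mulrA -exprMn; congr (_ * _ ^+ _).
by rewrite /recip_sum mulrDr divff ?ratX_neq0.
Qed.

(** The shift by D does not depend on a, so clearing denominators preserves the
    order, and in particular the distinctness, of monomials. *)
Lemma mlead_cleared D a : (mdeg a <= D)%N ->
  mlead (cleared_monomial D a) = ([multinom D | _ < n] + a)%MM.
Proof.
move=> le_aD.
have leadS i : mlead ('X_i ^+ 2 + 1 : {mpoly K[n]}) = (U_(i) *+ 2)%MM.
  rewrite mpolyXn mleadDl ?mleadXm ?mlead1 //.
  by apply: lt_mdeg_ltmc; rewrite mdeg0 mdegMn mdeg1.
have nzS i : ('X_i ^+ 2 + 1 : {mpoly K[n]}) != 0.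
  apply/eqP => /(congr1 (fun p => mdeg (mlead p))).
  by rewrite leadS mlead0 mdeg0 mdegMn mdeg1.
have nzX i k : ('X_i ^+ k : {mpoly K[n]}) != 0 by rewrite expf_neq0 // mpolyX_neq0.
rewrite mlead_prod => [|i _ _]; last first.
  exact: mulf_neq0 (expf_neq0 _ (nzS i)) (nzX i _).
apply/mnmP => j.
rewrite mnm_sumE (bigD1 j) //= big1 => [|i ne_ij].
  rewrite (mleadM (expf_neq0 _ (nzS j)) (nzX j _)) (mleadX _ (nzS j)) leadS mpolyXn mleadXm.
  rewrite !mnmDE !mulmnE mnm1E eqxx mnmE.
  have : (a j <= D)%N.
    by apply: leq_trans le_aD; rewrite mdegE (bigD1 j) //= leq_addr.
  by rewrite !mul1n; lia.
rewrite (mleadM (expf_neq0 _ (nzS i)) (nzX i _)) (mleadX _ (nzS i)) leadS mpolyXn mleadXm.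
by rewrite !mnmDE !mulmnE mnm1E (negbTE ne_ij) !mul0n.
Qed.

(** After clearing denominators, the leading monomial of Q is the only monomial of Q
    that contributes to the coefficient at its shift by D: the smaller ones have
    smaller leading monomials. *)
Lemma rsubst_recip_sum_inj : injective (rsubst recip_sum).
Proof.
apply: raddf_inj => Q /eqP; apply: contraTeq => nzQ.
pose D := msize Q.
have leD a : a \in msupp Q -> (mdeg a <= D)%N by move=> /msize_mdeg_lt/ltnW.
pose P := \sum_(a <- msupp Q) Q@_a *: cleared_monomial D a.
have PE : tofrac P = \prod_(i < n) ratX K i ^+ D * rsubst recip_sum Q.
  rewrite /P rmorph_sum /rsubst /mmap mulr_sumr.
  rewrite big_seq [RHS]big_seq; apply: eq_bigr => a /leD leaD.
  by rewrite /= -mul_mpolyC rmorphM /= cleared_monomialE // mulrCA.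
suff nzP : P != 0.
  apply: contra_neq nzP => Q0; apply/eqP.
  by rewrite -tofrac_eq0 PE Q0 mulr0.
apply/eqP => /(congr1 (mcoeff ([multinom D | _ < n] + mlead Q)%MM)).
rewrite mcoeff0 /P (bigD1_seq (mlead Q)) ?msupp_uniq ?mlead_supp //=.
have leL := leD _ (mlead_supp nzQ).
rewrite mcoeffD mcoeffZ -(mlead_cleared leL) [X in _ + X]raddf_sum big_seq_cond.
rewrite big1 ?addr0 => [/eqP|a /andP[aQ neaQ]].
  rewrite mulf_eq0 !mleadc_eq0 (negbTE nzQ) /=.
  apply/negP/prodf_neq0 => i _; rewrite mulf_neq0 ?expf_neq0 ?mpolyX_neq0 //.
  apply/eqP => /(congr1 (mcoeff 0%MM))/eqP.
  rewrite mcoeffD mcoeff0 mcoeff1 eqxx mpolyXn mcoeffX -mdeg_eq0 mdegMn mdeg1.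
  by rewrite add0r oner_eq0.
rewrite /= mcoeffZ [X in _ * X]mcoeff_gt_mlead ?mulr0 //.
rewrite (mlead_cleared (leD _ aQ)) (mlead_cleared leL) ltmc_add2r.
by rewrite lt_neqAle neaQ msupp_le_mlead.
Qed.

(** This reduces every evaluation of [Phi] to an identity in the field of rational
    functions. *)
Lemma Phi_eq (P : {mpoly K[n + n]}) (Q : {mpoly K[n]}) : is_Phi P Q -> Phi P = Q.
Proof.
move=> PQ; apply: xget_unique => // Q' [_ PQ'].
by apply: rsubst_recip_sum_inj; case: PQ => _ <-.
Qed.

End ReciprocalSums.

(** * Generating function of the elementary symmetric polynomials *)

Section ElementarySums.
Variable A : comNzRingType.

(** The value of the elementary symmetric polynomial at a family in an arbitrary
    commutative ring, as the generating function below is needed over fractions,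
    polynomials and scalars. *)
Definition esym_at n (z : 'I_n -> A) (k : nat) : A :=
  \sum_(h : {set 'I_n} | #|h| == k) \prod_(i in h) z i.

(** Expand the product over the set of indices at which the second summand is
    chosen, then group these sets by cardinality. *)
Lemma prod_esym_at n (z : 'I_n -> A) (w t : A) :
  \prod_(i < n) (w + z i * t) =
  \sum_(k < n.+1) esym_at z k * t ^+ k * w ^+ (n - k).
Proof.
under eq_bigr do rewrite addrC.
rewrite bigA_distr (partition_big (fun h : {set 'I_n} => inord #|h| : 'I_n.+1) predT) //=.
apply: eq_bigr => k _; rewrite /esym_at !mulr_suml.
have card_lt (h : {set 'I_n}) : (#|h| < n.+1)%N
  by have := max_card (mem h); rewrite card_ord.
apply: eq_big => [h|h /eqP <-]; first by rewrite -val_eqE /= inordK.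
rewrite inordK // (bigID (mem h)) /=; congr (_ * _).
  rewrite (eq_bigr (fun i => z i * t)) => [|i ->] //.
  by rewrite big_split /= prodr_const.
rewrite (eq_bigr (fun=> w)) => [|i /negbTE ->] //.
rewrite prodr_const; congr (_ ^+ _).
by apply/eqP; rewrite -(eqn_add2l #|h|) cardC card_ord subnKC // -ltnS.
Qed.

End ElementarySums.

Section ReciprocalVariables.
Variable A : comNzRingType.

Lemma eq_sum_ord (f : nat -> A) p q :
    (forall k, (p <= k)%N -> f k = 0) -> (forall k, (q <= k)%N -> f k = 0) ->
  \sum_(k < p) f k = \sum_(k < q) f k.
Proof.
move=> fp0 fq0; wlog le_pq : p q fp0 fq0 / (p <= q)%N => [th|].
  by case: (leqP p q) => [|/ltnW] /th -> //.
rewrite -(subnKC le_pq) big_split_ord /= [X in _ + X]big1 ?addr0 // => k _.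
by rewrite fp0 // leq_addr.
Qed.

(** The sum, which has at most one nonzero term, avoids a case distinction on the
    parity of m - j. *)
Lemma coef_exp1DXsqr p j m :
  ('X^j * (1 + 'X^2) ^+ p : {poly A})`_m =
  \sum_(k < (m./2).+1) ((m == j + 2 * k)%N * 'C(p, k))%N%:R.
Proof.
rewrite exprDn mulr_sumr coef_sum.
under eq_bigr do rewrite expr1n mul1r -exprM mulrnAr -exprD coefMn coefXn -mulrnA.
apply: (eq_sum_ord (f := fun k => ((m == j + 2 * k)%N * 'C(p, k))%N%:R)) => k hk.
  by rewrite bin_small ?muln0.
by rewrite (_ : (m == _) = false) //; lia.
Qed.

(** The coefficient of t^m in the identity
    prod_i (1 + x_i t) (1 + t / x_i) = prod_i ((1 + t^2) + (x_i + 1/x_i) t). *)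
Lemma esym_at_recip n (v : 'I_(n + n) -> A) m :
    (forall i, v (lshift n i) * v (rshift n i) = 1) -> (m <= n + n)%N ->
  esym_at v m =
  \sum_(maxn 0 (m - n) <= k < (m./2).+1)
     'C(n + 2 * k - m, k)%:R * esym_at (fun i => v (lshift n i) + v (rshift n i)) (m - 2 * k).
Proof.
move=> vV le_m; pose z i := v (lshift n i) + v (rshift n i); rewrite -/z.
have polyE N (u : 'I_N -> A) k : esym_at (fun i => (u i)%:P) k = (esym_at u k)%:P.
  rewrite /esym_at rmorph_sum; apply: eq_bigr => h _.
  by rewrite rmorph_prod.
have -> : esym_at v m = (\prod_(i < n + n) (1 + (v i)%:P * 'X))`_m.
  rewrite prod_esym_at coef_sum (bigD1 (Ordinal (le_m : (m < (n + n).+1)%N))) //=.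
  rewrite big1 => [|k /negbTE nek]; rewrite polyE expr1n mulr1 coefCM coefXn.
    by rewrite eqxx mulr1 addr0.
  by rewrite (_ : (m == k) = false) ?mulr0 // eq_sym; exact: nek.
rewrite big_split_ord /= -big_split /=.
rewrite (eq_bigr (fun i => 1 + 'X^2 + (z i)%:P * 'X)) => [|i _]; last first.
  have : (v (lshift n i))%:P * (v (rshift n i))%:P = 1 :> {poly A}.
    by rewrite -polyCM vV.
  rewrite /z polyCD; move: (v (lshift n i))%:P (v (rshift n i))%:P => a b ab1.
  by rewrite mulrDr mulr1 mulrDl mul1r mulrACA ab1 mul1r -expr2; ring.
rewrite prod_esym_at coef_sum.
rewrite (eq_bigr (fun j : 'I_n.+1 => \sum_(k < (m./2).+1)
    esym_at z j * ((m == j + 2 * k)%N * 'C(n - j, k))%N%:R)) => [|j _]; last first.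
  by rewrite (polyE n z j) -mulrA coefCM coef_exp1DXsqr mulr_sumr.
(* For k < m - n either there is no index j = m - 2k at most n, or the binomial
   coefficient 'C(n - j, k) vanishes, which explains the lower bound. *)
rewrite exchange_big /= big_geq_mkord [RHS]big_mkcond /=.
apply: eq_bigr => k _; have lek : (2 * k <= m)%N by have := ltn_ord k; lia.
case: ifP => hk.
  have lt_j : (m - 2 * k < n.+1)%N by lia.
  rewrite (bigD1 (Ordinal lt_j)) //= big1 ?addr0 => [|j /eqP nej].
    rewrite mulrC (_ : (m == _) = true) ?mul1n; last by apply/eqP => /=; lia.
    by congr ('C(_, _)%:R * _); lia.
  rewrite (_ : (m == _) = false) ?mul0n ?mulr0 //.
  by apply/negP => /eqP mE; apply: nej; apply: val_inj => /=; lia.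
rewrite big1 // => j _; have := ltn_ord j; case: eqP => [mE ltj|]; last by rewrite mulr0.
by rewrite bin_small ?mulr0 //; lia.
Qed.
End ReciprocalVariables.

(** * Orthogonal and symplectic characters of columns *)

Section CompleteSymmetric.
Variables (K : fieldType) (N : nat).
Implicit Types (a b : 'X_{1..N}) (k d : nat).

Lemma mcoeff_hsym k b : (hsym K N k)@_b = (mdeg b == k)%:R.
Proof.
rewrite raddf_sum /=; have [<-|neq_bk] := eqVneq (mdeg b) k.
  rewrite (bigD1 (BMultinom (ltnSn (mdeg b)))) //= mcoeffX eqxx.
  rewrite big1 ?addr0 // => a /andP[_ nea]; rewrite mcoeffX.
  rewrite (_ : (_ == _) = false) //.
  by apply: contraNF nea => /eqP ab; apply/eqP/val_inj.
rewrite big1 // => a /eqP dega; rewrite mcoeffX (_ : (_ == _) = false) //.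
by apply: contraNF neq_bk => /eqP <-; rewrite dega.
Qed.

Lemma hsym_lt0 (z : int) : z < 0 -> hsym K N z = 0.
Proof. by case: z. Qed.

Lemma mcoeffXM (p : {mpoly K[N]}) a b :
  ('X_[a] * p)@_b = if (a <= b)%MM then p@_(b - a) else 0.
Proof.
rewrite mulrC; case: ifPn => [le_ab|].
  by rewrite -[X in _@_X](submK le_ab) addmC mcoeffMX.
apply: contraNeq; rewrite -mcoeff_msupp (perm_mem (msuppMX p a)).
by case/mapP => c _ ->; rewrite lem_addr.
Qed.

Lemma mesym1_le (h : {set 'I_N}) b :
  (mesym1 h <= b)%MM = [forall i in h, (0 < b i)%N].
Proof.
apply/mnm_lepP/forall_inP => [hb i ih|hb i].
  by have := hb i; rewrite mnmE ih.
by rewrite mnmE; case: (boolP (i \in h)) => [/hb|].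
Qed.

(** A monomial b of degree d arises once for every set of k variables that all occur
    in b; the right-hand side counts these sets as an elementary symmetric
    polynomial of indicators. *)
Lemma mcoeff_mesymM_hsym k d b : (k <= d)%N ->
  (mesym N K k * hsym K N (d - k)%N)@_b =
  (mdeg b == d)%:R * esym_at (fun i => (0 < b i)%N%:R) k.
Proof.
move=> le_kd; rewrite mesymE mulr_suml raddf_sum mulr_sumr /=.
apply: eq_bigr => h /eqP card_h; rewrite mcoeffXM mesym1_le mcoeff_hsym.
case: ifPn => [/forall_inP hb|].
  rewrite big1 ?mulr1 => [|i /hb -> //].
  have le_hb : (mesym1 h <= b)%MM by rewrite mesym1_le; apply/forall_inP.
  have := congr1 (@mdeg N) (submK le_hb); rewrite mdegD mdeg_mesym1 card_h => <-.
  by rewrite -{2}(subnK le_kd) eqn_add2r.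
rewrite negb_forall_in => /exists_inP[i ih]; rewrite lt0n negbK => /eqP bi0.
by rewrite (bigD1 i) //= bi0 mul0r mulr0.
Qed.

(** By inclusion-exclusion: the coefficient of a monomial b is the alternating sum over
    all subsets of its support, that is prod_i (1 - [x_i occurs in b]), and a monomial
    of positive degree has nonempty support. *)
Lemma sum_mesym_hsym d : (0 < d)%N ->
  \sum_(k < d.+1) (-1) ^+ k * (mesym N K k * hsym K N (d - k)%N) = 0.
Proof.
move=> d_gt0; apply/mpolyP => b; rewrite raddf_sum mcoeff0 /=.
pose z (i : 'I_N) : K := (0 < b i)%N%:R.
rewrite (eq_bigr (fun k : 'I_d.+1 => (mdeg b == d)%:R * ((-1) ^+ k * esym_at z k))); last first.
  move=> k _; rewrite (_ : (-1) ^+ k = ((-1) ^+ k)%:MP); last first.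
    by rewrite rmorphXn rmorphN1.
  have lekd : (k <= d)%N by rewrite -ltnS.
  by rewrite mcoeffCM (mcoeff_mesymM_hsym b lekd) mulrCA.
rewrite -mulr_sumr; case: eqP => [deg_b|_]; last by rewrite mul0r.
(* No set of more than d variables divides a monomial of degree d, so the sum may run
   over all cardinalities, as in the expansion of the product. *)
rewrite mul1r (@eq_sum_ord _ (fun k => (-1) ^+ k * esym_at z k) _ N.+1) => [|k hk|k hk].
- have := prod_esym_at z 1 (-1).
  under [X in _ = X -> _]eq_bigr do rewrite expr1n mulr1 mulrC.
  move=> <-; apply/eqP/prodf_eq0.
  have [i bi] : exists i, (0 < b i)%N.
    apply/existsP; apply: contraTT d_gt0; rewrite negb_exists => /forallP b0.
    rewrite -deg_b lt0n negbK mdegE big1 // => i _.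
    by have := b0 i; rewrite lt0n negbK => /eqP.
  by exists i => //; rewrite /z bi mul1r subrr.
- rewrite /esym_at big1 ?mulr0 // => h /eqP card_h.
  have [/exists_inP[i ih /eqP bi0]|] := boolP [exists i in h, b i == 0%N].
    by rewrite (bigD1 i) //= /z bi0 mul0r.
  rewrite negb_exists_in => /forall_inP hb; move: hk; rewrite ltnNge -deg_b.
  rewrite mdegE (bigID (mem h)) /= -card_h -sum1_card.
  case/negP; apply: leq_trans (leq_addr _ _); apply: leq_sum => i /hb.
  by rewrite lt0n.
rewrite /esym_at big1 ?mulr0 // => h /eqP card_h.
by have := max_card (mem h); rewrite card_h card_ord leqNgt hk.
Qed.
End CompleteSymmetric.

Section Hessenberg.
Variables (A : comNzRingType) (e h : nat -> A).

(** The Jacobi-Trudi matrix of a column, with its first row replaced by r.  Leaving the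
    first row free makes the family stable under expansion along the first column, and
    covers the orthogonal and the symplectic determinant together. *)
Definition hessenberg (r : nat -> A) m : 'M[A]_m :=
  \matrix_(i < m, j < m)
    if i == 0%N :> nat then r j else if (j.+1 < i)%N then 0 else h (j.+1 - i).

Hypotheses (e0 : e 0%N = 1) (h0 : h 0%N = 1).
Hypothesis newton : forall d, (0 < d)%N -> \sum_(k < d.+1) (-1) ^+ k * (e k * h (d - k)%N) = 0.

Lemma newton_rec m : e m.+1 = \sum_(j < m.+1) (-1) ^+ j * h j.+1 * e (m - j)%N.
Proof.
have := newton (ltn0Sn m); rewrite big_ord_recr /= subnn h0 mulr1 => /eqP.
rewrite addrC addr_eq0 => /eqP /(congr1 ( *%R ((-1) ^+ m.+1))).
rewrite mulrA -expr2 sqrr_sign mul1r => ->.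
rewrite (reindex_inj rev_ord_inj) /= mulrN mulr_sumr -sumrN.
apply: eq_bigr => j _; rewrite subSS; have lej : (j <= m)%N by rewrite -ltnS.
rewrite mulrA -exprD (_ : (m.+1 + (m - j) = j.+1 + (m - j) * 2)%N); last by lia.
rewrite exprD exprM sqrr_sign mulr1 exprS mulN1r mulNr opprK.
by rewrite (_ : (m.+1 - (m - j) = j.+1)%N) ?[e _ * _]mulrC ?mulrA //; lia.
Qed.

(** The first column is (r 0, 1, 0, ..., 0).  Deleting it with the first row gives the
    smaller matrix of the same form with first row h_1, h_2, ..., whose determinant is,
    by induction and [newton_rec], the e of its size; deleting it with the second row
    gives the smaller matrix of the same form with r shifted. *)
Lemma det_hessenberg r m :
  \det (hessenberg r m.+1) = \sum_(j < m.+1) (-1) ^+ j * r j * e (m - j)%N.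
Proof.
elim: m r => [|m IHm] r.
  by rewrite det_mx11 mxE big_ord1 /= expr0 mul1r e0 mulr1.
rewrite (expand_det_col _ ord0) !big_ord_recl /= [X in _ + (_ + X)]big1 ?addr0; last first.
  by move=> i _; rewrite mxE /= mul0r.
set M := hessenberg r m.+2; rewrite !mxE /= /cofactor.
have -> : row' ord0 (col' ord0 M) = hessenberg (fun j => h j.+1) m.+1.
  apply/matrixP => i j; rewrite !mxE /= /bump /= !add1n.
  by case: (nat_of_ord i) => //= i'; rewrite subSS.
have -> : row' (lift ord0 ord0) (col' ord0 M) = hessenberg (fun j => r j.+1) m.+1.
  apply/matrixP => i j; rewrite !mxE /= /bump /= !add1n.
  by case: (nat_of_ord i) => //= i'; rewrite subSS.
rewrite !IHm -newton_rec h0 expr0 expr1 !mul1r mulN1r subn0; congr (_ + _).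
rewrite -sumrN big_ord_recl; congr (_ + _).
  by rewrite expr0 mul1r mulN1r mulNr subn0 subSS subn0.
apply: eq_bigr => j _; rewrite /= /bump /= !add1n subSS.
by rewrite [in RHS]exprS !mulN1r !mulNr.
Qed.
End Hessenberg.

Section ColumnCharacters.
Variables (K : numFieldType) (N : nat).
Local Notation e := (mesym N K).
Local Notation h := (fun k : nat => hsym K N k).
Let newtonE := @sum_mesym_hsym K N.

Lemma hsym0 : hsym K N 0 = 1.
Proof.
by apply/mpolyP => b; rewrite (@mcoeff_hsym _ _ 0) mcoeff1 mdeg_eq0.
Qed.

Lemma hsym_shift (i j : nat) :
  hsym K N (1 - i%:Z + j%:Z) = if (j.+1 < i)%N then 0 else h (j.+1 - i)%N.
Proof.
case: ltnP => hij; first by rewrite hsym_lt0 //; lia.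
by congr hsym; lia.
Qed.

Lemma hsym_shiftN (i j : nat) : (0 < i + j)%N ->
  hsym K N (1 - i%:Z - j%:Z) = ((i + j)%N == 1%N)%:R.
Proof.
case: eqP => [ij1|ij1] ij0; last by rewrite hsym_lt0 //; lia.
by rewrite -hsym0; congr hsym; lia.
Qed.

(** The subtracted terms all have negative degree. *)
Lemma osym_column m : osym K N (nseq m 1%N) = e m.
Proof.
rewrite /osym; move: (size_nseq m 1%N) (nth_nseq 0%N m 1%N).
move: (nseq m 1%N) => la size_la nth_la; rewrite -size_la.
transitivity (\det (hessenberg h (fun j => h j.+1) (size la))).
  congr (\det _); apply/matrixP => i j; rewrite !mxE nth_la -size_la ltn_ord.
  rewrite hsym_shift [X in _ - X]hsym_lt0 ?subr0; last by lia.
  by case: (nat_of_ord i) => //= [|i']; rewrite ?subn0.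
case: (size la) => [|p]; first by rewrite det_mx00 mesym0E.
rewrite (det_hessenberg (e := e) (h := h) (mesym0E _ _) hsym0 newtonE).
by rewrite (newton_rec (e := e) (h := h) hsym0 newtonE).
Qed.

(** The added terms double the first column, which cancels the factor 1/2, and
    otherwise only add h_0 = 1 in the second entry of the first row; that entry
    contributes -e_(m-1). *)
Lemma spsym_column m :
  spsym K N (nseq m.+1 1%N) = e m.+1 - (if m is m'.+1 then e m' else 0).
Proof.
rewrite /spsym; move: (size_nseq m.+1 1%N) (nth_nseq 0%N m.+1 1%N).
rewrite -[nseq _ _]/(1%N :: nseq m 1%N); move: (1%N :: _) => la.
case: la => // x la size_la nth_la.
pose r j := h j.+1 + (j == 1%N)%:R; pose s := size (x :: la).
transitivity (\det (hessenberg h r s)).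
  pose d : 'rV[{mpoly K[N]}]_s := \row_j (if j == 0%N :> nat then 2%:R else 1).
  rewrite (_ : \matrix_(i, j) _ = hessenberg h r s *m diag_mx d).
    rewrite det_mulmx det_diag big_ord_recl big1 => [|j _]; last by rewrite mxE.
    rewrite mxE /= mulr1 mulr_natr -scaler_nat scalerA mulVf ?scale1r //.
    by rewrite pnatr_eq0.
  apply/matrixP => i j; rewrite mul_mx_diag !mxE nth_la -size_la ltn_ord.
  rewrite hsym_shift; case: (nat_of_ord j) => [|j'] /=.
    rewrite subr0 -[1 - i%:Z]addr0 (hsym_shift i 0).
    by case: (nat_of_ord i) => [|i'] /=; rewrite /r ?addr0 mulr_natr mulr2n.
  rewrite mulr1 hsym_shiftN ?addnS //.
  by case: (nat_of_ord i) => [|i'] /=; rewrite ?addr0 // subn0.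
rewrite /s size_la (det_hessenberg (e := e) (h := h) (mesym0E _ _) hsym0 newtonE).
rewrite (newton_rec (e := e) (h := h) hsym0 newtonE) /r.
under eq_bigr do rewrite mulrDr mulrDl.
rewrite big_split /=; congr (_ + _).
case: (m) => [|m']; first by rewrite big_ord1 /= mulr0 mul0r oppr0.
rewrite !big_ord_recl big1 /= => [|j _]; last by rewrite mulr0 mul0r.
by rewrite !mulr0 mul0r add0r addr0 expr1 mulr1 mulN1r subSS subn0.
Qed.
End ColumnCharacters.

(** * Monic Chebyshev polynomials and powers *)

Section Chebyshev.
Variable K : numFieldType.
Local Notation T := (chebT_monic K).

Lemma chebT_rec m : chebT K m.+2 = 2%:R *: ('X * chebT K m.+1) - chebT K m.
Proof.
have pairE p : chebT_pair K p.+1 =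
    ((chebT_pair K p).2, 2%:R *: ('X * (chebT_pair K p).2) - (chebT_pair K p).1).
  by rewrite /=; case: (chebT_pair K p).
by rewrite /chebT !pairE.
Qed.

Let two_neq0 : 2%:R != 0 :> K. Proof. by rewrite pnatr_eq0. Qed.

Lemma chebT_monic1 : T 1 = 'X.
Proof. by rewrite /chebT_monic /chebT /= comp_polyX scalerA divff ?scale1r. Qed.

Lemma chebT_monic_rec m : T m.+3 = 'X * T m.+2 - T m.+1.
Proof.
rewrite /chebT_monic /= chebT_rec comp_polyB comp_polyZ comp_polyM comp_polyX.
rewrite scalerBr -!scalerAl -!scalerAr !scalerA; congr (_ *: _ - _).
by rewrite mulfK.
Qed.

Lemma chebT_monic2 : T 2 = 'X^2 - 2%:R.
Proof.
rewrite /chebT_monic /= chebT_rec /chebT /=.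
rewrite comp_polyB comp_polyZ comp_polyM comp_polyX.
rewrite (_ : 1 \Po _ = 1); last by rewrite -polyC1 comp_polyC.
rewrite scalerBr -!scalerAl -!scalerAr !scalerA -expr2.
by rewrite mulfK // mulfV // scale1r scaler_nat.
Qed.

Lemma mulX_chebT_monic m : 'X * T m.+2 = T m.+3 + T m.+1.
Proof. by rewrite chebT_monic_rec subrK. Qed.

Lemma mulX_chebT_monic1 : 'X * T 1 = T 2 + 2%:R *: T 0.
Proof. by rewrite chebT_monic1 chebT_monic2 /T scaler_nat /= subrK expr2. Qed.

Lemma chebT_monic_monic m : T m \is monic /\ size (T m) = m.+1.
Proof.
have subK (p q : {poly K}) : p \is monic -> (size q < size p)%N ->
    p - q \is monic /\ size (p - q) = size p.
  move=> /monicP mon_p lt_qp; have lt_Nqp : (size (- q) < size p)%N by rewrite size_polyN.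
  by rewrite monicE (lead_coefDl lt_Nqp) (size_polyDl lt_Nqp) mon_p.
suff [] : (T m \is monic /\ size (T m) = m.+1) /\
          (T m.+1 \is monic /\ size (T m.+1) = m.+2) by [].
elim: m => [|m [[mon0 sz0] [mon1 sz1]]].
  by rewrite chebT_monic1 monic1 size_poly1 monicX size_polyX.
split=> //; case: m mon0 sz0 mon1 sz1 => [|m] mon0 sz0 mon1 sz1.
  rewrite chebT_monic2 -(size_polyXn K 2); apply: subK; first exact: monicXn.
  by rewrite size_polyXn -polyC_natr size_polyC two_neq0.
rewrite chebT_monic_rec.
have szX : size ('X * T m.+2) = m.+4 by rewrite mulrC size_mulX ?monic_neq0 // sz1.
by rewrite -szX; apply: subK; rewrite ?monicMl ?monicX // szX sz0.
Qed.

(** Induction on s by Pascal's rule and u T_j = T_(j+1) + T_(j-1) for j >= 2.  The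
    exceptional product u T_1 = T_2 + 2 T_0 occurs when s is odd, and its coefficient 2
    accounts for both halves of the central binomial coefficient of the next row. *)
Lemma exprX_chebT_monic s :
  'X^s = \sum_(k < (s./2).+1) 'C(s, k)%:R *: T (s - 2 * k).
Proof.
have mulT j : (2 <= j)%N -> 'X * T j = T j.+1 + T j.-1.
  by case: j => [|[|j]] // _; exact: mulX_chebT_monic.
have even_odd p : 'X^(2 * p) = \sum_(k < p.+1) 'C(2 * p, k)%:R *: T (2 * p - 2 * k) ->
   'X^((2 * p).+1) = \sum_(k < p.+1) 'C((2 * p).+1, k)%:R *: T ((2 * p).+1 - 2 * k).
  move=> E; transitivity (\sum_(k < p.+1) 'C(2 * p, k)%:R *: T ((2 * p).+1 - 2 * k) +
                         \sum_(k < p) 'C(2 * p, k)%:R *: T ((2 * p).+1 - 2 * k.+1)).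
    rewrite exprS E mulr_sumr !big_ord_recr /= addrAC -big_split /=; congr (_ + _).
      apply: eq_bigr => k _; have := ltn_ord k => ltk.
      rewrite -scalerAr mulT; last by lia.
      by rewrite scalerDr; congr (_ *: T _ + _ *: T _); lia.
    by rewrite -scalerAr subnn subSnn -chebT_monic1 mulr1.
  rewrite big_ord_recl [RHS]big_ord_recl /= !bin0 -addrA -big_split; congr (_ + _).
  by apply: eq_bigr => k _; rewrite /bump /= add1n [in RHS]binS natrD scalerDl.
have odd_even p :
   'X^((2 * p).+1) = \sum_(k < p.+1) 'C((2 * p).+1, k)%:R *: T ((2 * p).+1 - 2 * k) ->
   'X^(2 * p.+1) = \sum_(k < p.+2) 'C(2 * p.+1, k)%:R *: T (2 * p.+1 - 2 * k).
  move=> E; transitivity (\sum_(k < p.+2) 'C((2 * p).+1, k)%:R *: T ((2 * p).+2 - 2 * k) +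
                         \sum_(k < p.+1) 'C((2 * p).+1, k)%:R *: T ((2 * p).+2 - 2 * k.+1)).
    rewrite (_ : 2 * p.+1 = (2 * p).+2)%N; last by lia.
    rewrite exprS E mulr_sumr [LHS]big_ord_recr /=.
    rewrite [X in _ = X + _]big_ord_recr [X in _ = X + _ + _]big_ord_recr /=.
    rewrite [X in _ = _ + X]big_ord_recr /= -[X in _ = X + _]addrA addrACA.
    rewrite -big_split; congr (_ + _).
      apply: eq_bigr => k _; have := ltn_ord k => ltk.
      rewrite -scalerAr mulT; last by lia.
      by rewrite scalerDr; congr (_ *: T _ + _ *: T _); lia.
    rewrite -scalerAr (_ : (2 * p).+1 - 2 * p = 1)%N; last by lia.
    rewrite (_ : (2 * p).+2 - 2 * p = 2)%N; last by lia.
    rewrite (_ : (2 * p).+2 - 2 * p.+1 = 0)%N; last by lia.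
    rewrite mulX_chebT_monic1 scalerDr -addrA; congr (_ + _).
    rewrite (_ : 'C((2 * p).+1, p.+1) = 'C((2 * p).+1, p)).
      by rewrite -scalerDl scalerA mulr_natr mulr2n.
    by rewrite -bin_sub; [congr 'C(_, _)|]; lia.
  rewrite (_ : 2 * p.+1 = (2 * p).+2)%N; last by lia.
  rewrite big_ord_recl [RHS]big_ord_recl /= !bin0 -addrA -big_split; congr (_ + _).
  by apply: eq_bigr => k _; rewrite /bump /= add1n [in RHS]binS natrD scalerDl.
have both p : 'X^(2 * p) = \sum_(k < p.+1) 'C(2 * p, k)%:R *: T (2 * p - 2 * k).
  elim: p => [|p IHp]; last exact/odd_even/even_odd.
  by rewrite big_ord1 bin0 scale1r.
have [p [->|->]] : exists p, s = (2 * p)%N \/ s = (2 * p).+1.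
- by exists s./2; lia.
- by rewrite (_ : (2 * p)./2 = p); [exact: both | lia].
by rewrite (_ : (2 * p).+1./2 = p); [exact: even_odd | lia].
Qed.

Lemma tau0 s : tau K s 0 = 1.
Proof.
rewrite /tau; case: s => //= s; rewrite !subn0 subn1 /= fact0 mul1n mulnC factS.
by rewrite divff // pnatr_eq0 -lt0n muln_gt0 fact_gt0.
Qed.

Lemma tau_double p : tau K (2 * p.+1) p.+1 = 2%:R.
Proof.
rewrite /tau muln_eq0 /= subnn fact0 muln1.
rewrite (_ : 2 * p.+1 - p.+1 - 1 = p)%N; last by lia.
rewrite factS (_ : p`! * (2 * p.+1) = 2 * (p.+1 * p`!))%N; last by lia.
by rewrite natrM mulfK // pnatr_eq0 -lt0n muln_gt0 fact_gt0.
Qed.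

(** In terms of j = s - 2k no truncated subtraction remains. *)
Lemma tauE j k p : (j + k)%N = p.+1 ->
  tau K (j + 2 * k) k = (p`! * (j + 2 * k))%N%:R / (k`! * j`!)%N%:R.
Proof.
move=> jkp; rewrite /tau ifN; last by apply/eqP; lia.
by congr ((_`! * _)%N%:R / (_ * _`!)%N%:R); lia.
Qed.

Lemma tau_rec s k : (2 * k < s.+1)%N ->
  tau K s.+3 k.+1 = tau K s.+2 k.+1 + tau K s.+1 k.
Proof.
move=> lt_ks; pose j := (s - 2 * k)%N.
rewrite (_ : s.+3 = j.+1 + 2 * k.+1)%N; last by rewrite /j; lia.
rewrite (_ : s.+2 = j + 2 * k.+1)%N; last by rewrite /j; lia.
rewrite (_ : s.+1 = j.+1 + 2 * k)%N; last by rewrite /j; lia.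
rewrite (tauE (p := (j + k).+1)) ?(tauE (p := j + k)); try lia.
have nz p : p`!%:R != 0 :> K by rewrite pnatr_eq0 -lt0n fact_gt0.
have nzS p : 1 + p%:R != 0 :> K by rewrite nat1r pnatr_eq0.
rewrite !factS !natrM !natrD !natrM !mulrS !natrD.
by field; rewrite !nz !nzS.
Qed.

(** Induction on s along the three-term recurrence, whose effect on coefficients is
    [tau_rec].  For s + 3 even, the constant term comes from T_(s+1) alone, and
    [tau_rec] is replaced there by the constant value of [tau_double]. *)
Lemma chebT_monic_expansion s :
  T s = \sum_(k < (s./2).+1) ((-1) ^+ k * tau K s k) *: 'X^(s - 2 * k).
Proof.
pose X s := \sum_(k < (s./2).+1) ((-1) ^+ k * tau K s k) *: 'X^(s - 2 * k) : {poly K}.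
suff [] : (T s = X s /\ T s.+1 = X s.+1) by [].
elim: s => [|s [IH0 IH1]].
  rewrite /X !big_ord1 !tau0 !mul1r !scale1r; split => //; exact: chebT_monic1.
split=> //; case: s IH0 IH1 => [|s] IH0 IH1.
  rewrite chebT_monic2 /X /= !big_ord_recl big_ord0 /= !tau0 (tau_double 0).
  by rewrite expr0 expr1 mul1r scale1r addr0 mulN1r scaleNr scaler_nat.
rewrite chebT_monic_rec IH0 IH1 /X {X IH0 IH1}.
have mulX q : (q <= (s.+2)./2)%N ->
    'X * (\sum_(k < q.+1) ((-1) ^+ k * tau K s.+2 k) *: 'X^(s.+2 - 2 * k)) =
    'X^(s.+3) - \sum_(k < q) ((-1) ^+ k * tau K s.+2 k.+1) *: 'X^(s.+1 - 2 * k).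
  move=> le_q; rewrite mulr_sumr big_ord_recl /= tau0 expr0 mul1r scale1r subn0 -exprS.
  rewrite -sumrN; congr (_ + _); apply: eq_bigr => k _; have ltk := ltn_ord k.
  rewrite -scalerAr -exprS /bump /= add1n exprS mulN1r mulNr scaleNr.
  by congr (- (_ *: 'X^_)); lia.
rewrite [RHS]big_ord_recl /= tau0 expr0 mul1r scale1r subn0 (mulX _ (leqnn _)).
rewrite -addrA; congr (_ + _); rewrite -opprD /=.
have term k : (2 * k < s.+1)%N ->
    ((-1) ^+ k * tau K s.+2 k.+1) *: 'X^(s.+1 - 2 * k) +
    ((-1) ^+ k * tau K s.+1 k) *: 'X^(s.+1 - 2 * k) =
    - (((-1) ^+ k.+1 * tau K s.+3 k.+1) *: 'X^(s.+3 - 2 * k.+1)).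
  move=> ltk; rewrite -scalerDl -mulrDr -tau_rec // -scaleNr exprS mulN1r mulNr opprK.
  by congr (_ *: 'X^_); lia.
have [even_s|odd_s] : uphalf s = s./2 \/ uphalf s = (s./2).+1 by lia.
  rewrite even_s -big_split -sumrN; apply: eq_bigr => k _.
  have ltk := ltn_ord k; rewrite [X in - X]term ?opprK //; lia.
rewrite odd_s [X in _ + X]big_ord_recr [RHS]big_ord_recr /= addrA opprD -big_split -sumrN.
congr (_ + _).
  apply: eq_bigr => k _; have ltk := ltn_ord k; rewrite [X in - X]term ?opprK //; lia.
rewrite (_ : s.+3 = 2 * (s./2).+2)%N; last by lia.
rewrite (_ : s.+1 = 2 * (s./2).+1)%N; last by lia.
by rewrite !tau_double !subnn /bump /= add1n !exprS !mulN1r !mulNr !scaleNr.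
Qed.
End Chebyshev.

(** * Expansions in monic polynomials and bialternants *)

(** Both sides range over the pairs (j, k) with j + 2k <= n, grouped by j on the left and
    by m = j + 2k on the right. *)
Lemma triangle_sum (V : zmodType) (F : nat -> nat -> V) n :
  \sum_(j < n.+1) \sum_(k < ((n - j)./2).+1) F j k =
  \sum_(m < n.+1) \sum_(k < (m./2).+1) F (m - 2 * k)%N k.
Proof.
transitivity (\sum_(j < n.+1) \sum_(k < n.+1 | (j + 2 * k <= n)%N) F j k).
  apply: eq_bigr => j _; have ltj := ltn_ord j.
  rewrite (big_ord_widen n.+1 (F j)); last by lia.
  by apply: eq_bigl => k; lia.
transitivity (\sum_(m < n.+1) \sum_(k < n.+1 | (2 * k <= m)%N) F (m - 2 * k)%N k); last first.
  apply: eq_bigr => m _; have ltm := ltn_ord m.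
  rewrite (big_ord_widen n.+1 (fun k => F (m - 2 * k)%N k)); last by lia.
  by apply: eq_bigl => k; lia.
rewrite (exchange_big_dep predT) //= [RHS](exchange_big_dep predT) //=.
apply: eq_bigr => k _.
transitivity (\sum_(0 + 2 * k <= m < n.+1) F (m - 2 * k)%N k); last by rewrite add0n big_geq_mkord.
rewrite big_addn big_mkord.
rewrite (big_ord_widen n.+1 (fun i => F (i + 2 * k - 2 * k)%N k)); last by lia.
by apply: eq_big => j; rewrite ?addnK //; lia.
Qed.

Definition monic_sequence (A : nzRingType) (p : nat -> {poly A}) :=
  forall k, p k \is monic /\ size (p k) = k.+1.

Lemma monic_sequence_map (A B : nzRingType) (f : {rmorphism A -> B}) p :
  monic_sequence p -> monic_sequence (fun k => map_poly f (p k)).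
Proof.
move=> mon k; have [mon_p sz_p] := mon k.
by rewrite monic_map ?size_map_poly_id0 // (monicP mon_p) rmorph1 oner_neq0.
Qed.

(** The leading coefficient isolates the term m = 0; the others follow by induction. *)
Lemma monic_sequence_free (A : comNzRingType) (p : nat -> {poly A}) n (c d : nat -> A) :
    monic_sequence p ->
    \sum_(m < n.+1) c m *: p (n - m)%N = \sum_(m < n.+1) d m *: p (n - m)%N ->
  forall m, (m <= n)%N -> c m = d m.
Proof.
move=> mon; have lead1 k : (p k)`_k = 1.
  by have [/monicP <- sz_p] := mon k; rewrite lead_coefE sz_p.
elim: n c d => [|n IHn] c d Ecd.
  case=> // _; move: Ecd => /(congr1 (coefp 0)); rewrite !big_ord1 /= !coefZ.
  by rewrite lead1 !mulr1.
have c0 : c 0%N = d 0%N.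
  have tail (a : nat -> A) : (\sum_(i < n.+1) a (bump 0 i) *: p (n.+1 - bump 0 i)%N)`_n.+1 = 0.
    rewrite coef_sum big1 // => i _.
    by rewrite coefZ nth_default ?mulr0 // (proj2 (mon _)) subSS ltnS leq_subr.
  have := congr1 (coefp n.+1) Ecd.
  rewrite [in LHS]big_ord_recl [in RHS]big_ord_recl /= !coefD !coefZ lead1 !mulr1.
  by rewrite !tail !addr0.
case=> // m lem; apply: (IHn (c \o S) (d \o S)) => //.
by move: Ecd; rewrite [in LHS]big_ord_recl [in RHS]big_ord_recl /= c0 => /addrI.
Qed.

(** The matrix is a unitriangular matrix of coefficients times a Vandermonde matrix.
    Its rows are listed by decreasing degree, so rows and columns are first reversed;
    the two signs cancel and the differences change orientation. *)
Lemma det_monic_sequence (A : comNzRingType) (p : nat -> {poly A}) n (y : 'I_n.+1 -> A) :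
    monic_sequence p ->
  \det (\matrix_(i < n.+1, j < n.+1) (p (n - i)%N).[y j]) =
  \prod_(i < n.+1) \prod_(j < n.+1 | (i < j)%N) (y i - y j).
Proof.
move=> mon; set M := \matrix_(i, j) _.
pose s : {perm 'I_n.+1} := perm (@rev_ord_inj n.+1).
pose L := \matrix_(i < n.+1, k < n.+1) (p i)`_k.
pose a := \row_(j < n.+1) y (rev_ord j).
have ML : row_perm s (col_perm s M) = L *m Vandermonde n.+1 a.
  apply/matrixP => i j; rewrite !mxE !permE /= subSS subKn -1?ltnS //.
  rewrite horner_coef (proj2 (mon _)).
  rewrite (big_ord_widen n.+1 (fun k => (p i)`_k * y (rev_ord j) ^+ k)) //.
  rewrite big_mkcond; apply: eq_bigr => k _; rewrite !mxE.
  by case: ltnP => // le_ik; rewrite nth_default ?mul0r // (proj2 (mon _)).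
have detL : \det L = 1.
  rewrite det_trig => [|]; last first.
    apply/is_trig_mxP => i j lt_ij; rewrite mxE nth_default // (proj2 (mon _)) //.
  rewrite big1 // => i _; rewrite mxE.
  by have [/monicP <- sz_p] := mon i; rewrite lead_coefE sz_p.
have <- : \det (row_perm s (col_perm s M)) = \det M.
  rewrite row_permE col_permE !det_mulmx !det_perm odd_permV.
  by rewrite mulrCA -expr2 sqrr_sign mulr1.
rewrite ML det_mulmx detL mul1r det_Vandermonde.
rewrite (reindex_inj rev_ord_inj) /=.
rewrite (eq_bigr (fun i : 'I_n.+1 => \prod_(j < n.+1 | (j < i)%N) (y j - y i))).
  by rewrite (exchange_big_dep predT).
move=> i _; rewrite (reindex_inj rev_ord_inj) /=; apply: eq_big => [j|j _].
  by have := ltn_ord i; have := ltn_ord j; lia.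
by rewrite !mxE !rev_ordK.
Qed.

(** * The polynomials [ez] *)

Section Phi.
Variables (K : numFieldType) (n : nat).
Local Notation A := {mpoly K[n]}.
Local Notation e := (mesym n K).

Definition ez_expansion m : A :=
  \sum_(maxn 0 (m - n) <= k < (m./2).+1) 'C(n + 2 * k - m, k)%:R *: e (m - 2 * k).

Lemma is_Phi_mesym m : (m <= n + n)%N -> is_Phi (mesym (n + n) K m) (ez_expansion m).
Proof.
move=> le_m; split.
  by rewrite rpred_sum // => k _; rewrite scaler_nat rpredMn // mesym_sym.
rewrite rsubst_mesym -/(esym_at (@recip_vars K n) m) esym_at_recip //; last first.
  move=> i; rewrite /recip_vars -[lshift n i]/(unsplit (inl i)) -[rshift n i]/(unsplit (inr i)).
  by rewrite !unsplitK divff // ratX_neq0.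
rewrite -/(rsubst (@recip_sum K n) _) /ez_expansion rmorph_sum; apply: eq_bigr => k _ /=.
rewrite scaler_nat raddfMn -[RHS]mulr_natl; congr (_ * _).
rewrite -[RHS]/(rsubst _ _) rsubst_mesym /esym_at; apply: eq_bigr => h _; apply: eq_bigr => i _.
rewrite /recip_vars -[lshift n i]/(unsplit (inl i)) -[rshift n i]/(unsplit (inr i)).
by rewrite !unsplitK.
Qed.

Lemma ezE m : (m <= n + n)%N -> ez K n m = ez_expansion m.
Proof. by move=> le_m; apply: Phi_eq; exact: is_Phi_mesym. Qed.

Lemma oz_column m : oz K n (nseq m 1%N) = ez K n m.
Proof. by rewrite /oz osym_column. Qed.

(** [Phi] is additive where it is defined, and [is_Phi_mesym] provides both terms. *)
Lemma spz_column m : (m < n + n)%N ->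
  spz K n (nseq m.+1 1%N) = ez K n m.+1 - (if m is m'.+1 then ez K n m' else 0).
Proof.
move=> lt_m; rewrite ezE //; apply: Phi_eq; rewrite spsym_column.
have [sym1 E1] := is_Phi_mesym lt_m.
case: m lt_m sym1 E1 => [|m'] lt_m sym1 E1; first by rewrite !subr0.
have le_m' : (m' <= n + n)%N by lia.
rewrite ezE //; have [sym2 E2] := is_Phi_mesym le_m'.
split; first by apply: rpredB; [exact: sym1 | exact: sym2].
by rewrite [LHS]raddfB [RHS]raddfB /= E1 E2.
Qed.

Lemma ez_sum_spz m : (m <= n)%N ->
  ez K n m = \sum_(0 <= k < (m./2).+1) spz K n (nseq (m - 2 * k) 1%N).
Proof.
have spz0 : spz K n [::] = ez K n 0 by rewrite /spz /ez mesym0E.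
have spz1 : (1 <= n)%N -> spz K n [:: 1%N] = ez K n 1.
  by move=> n1; rewrite (@spz_column 0) ?subr0 //; lia.
rewrite big_mkord; elim/ltn_ind: m => -[|[|m]] IHm le_m.
- by rewrite big_ord1 spz0.
- by rewrite big_ord1 spz1.
rewrite big_ord_recl (@spz_column m.+1) /=; last by lia.
rewrite [X in _ + X](_ : _ = ez K n m) ?subrK // IHm; try lia.
by apply: eq_bigr => k _; congr (spz _ _ (nseq _ _)); rewrite /bump /=; lia.
Qed.

Local Notation T k := (map_poly (in_alg A) (chebT_monic K k)).

Lemma ez_expansion_small m : (m <= n)%N ->
  ez_expansion m = \sum_(k < (m./2).+1) 'C(n + 2 * k - m, k)%:R *: e (m - 2 * k).
Proof. by move=> le_m; rewrite /ez_expansion (eqP le_m) big_mkord. Qed.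

Lemma prod_subX_mesym :
  \prod_(j < n) ('X - ('X_j : A)%:P) =
  \sum_(m < n.+1) ((-1) ^+ m * e m) *: 'X^(n - m) :> {poly A}.
Proof.
have esymC m : esym_at (fun j : 'I_n => ('X_j : A)%:P) m = (e m)%:P.
  rewrite /esym_at /mesym rmorph_sum; apply: eq_bigr => h _.
  by rewrite rmorph_prod.
rewrite (eq_bigr (fun j : 'I_n => 'X + ('X_j : A)%:P * (-1))).
  rewrite prod_esym_at; apply: eq_bigr => m _.
  by rewrite esymC -mul_polyC polyCM rmorphXn rmorphN1 [_ * (e m)%:P]mulrC.
by move=> j _; rewrite mulrN1.
Qed.

(** Substitute the Chebyshev expansion of the powers of u into the expansion of the
    product in powers of u.  The coefficient of T_(n-m) collects the terms
    'C(n - j, k) e_j with j + 2k = m, and (-1)^j = (-1)^m for these. *)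
Lemma prod_subX_chebT :
  \prod_(j < n) ('X - ('X_j : A)%:P) =
  \sum_(m < n.+1) ((-1) ^+ m * ez_expansion m) *: T (n - m)%N :> {poly A}.
Proof.
rewrite prod_subX_mesym.
pose F j k := ((-1) ^+ j * e j * 'C(n - j, k)%:R) *: T (n - j - 2 * k)%N.
transitivity (\sum_(j < n.+1) \sum_(k < ((n - j)./2).+1) F j k).
  apply: eq_bigr => j _; rewrite -(map_polyXn (in_alg A)) exprX_chebT_monic.
  rewrite rmorph_sum scaler_sumr; apply: eq_bigr => k _ /=.
  by rewrite linearZ /= scalerA /F scaler_nat.
rewrite triangle_sum; apply: eq_bigr => m _; have ltm := ltn_ord m.
rewrite ez_expansion_small // mulr_sumr scaler_suml; apply: eq_bigr => k _.
have ltk := ltn_ord k; rewrite /F (_ : n - (m - 2 * k) - 2 * k = n - m)%N; last by lia.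
congr (_ *: _).
rewrite scaler_nat -mulrA mulr_natr; rewrite (_ : n - (m - 2 * k) = n + 2 * k - m)%N; last by lia.
congr (_ * _).
by rewrite -[LHS]signr_odd -[RHS]signr_odd oddB ?mul2n ?odd_double ?addbF //; lia.
Qed.

(** Compare the coefficients of powers of u on the two sides of [prod_subX_chebT], after
    expanding the Chebyshev polynomials. *)
Lemma mesym_sum_ez m : (m <= n)%N ->
  e m = \sum_(0 <= k < (m./2).+1)
          ((-1) ^+ k * tau K (n - m + 2 * k)%N k) *: ez K n (m - 2 * k)%N.
Proof.
move=> le_m; rewrite big_mkord.
pose b j k : A := ((-1) ^+ k * tau K (n - j) k)%:A.
pose G j k := ((-1) ^+ j * ez_expansion j * b j k) *: 'X^(n - j - 2 * k) : {poly A}.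
pose d m := \sum_(k < (m./2).+1) (-1) ^+ m * ez_expansion (m - 2 * k) * b (m - 2 * k)%N k.
have -> : e m = (-1) ^+ m * d m.
  apply: (can_inj (signrMK m)); rewrite signrMK.
  apply: (monic_sequence_free (p := fun k => 'X^k) (c := fun m => (-1) ^+ m * e m)) le_m.
    by move=> k; rewrite monicXn size_polyXn.
  rewrite -prod_subX_mesym prod_subX_chebT.
  transitivity (\sum_(j < n.+1) \sum_(k < ((n - j)./2).+1) G j k).
    apply: eq_bigr => j _; rewrite chebT_monic_expansion rmorph_sum scaler_sumr.
    apply: eq_bigr => k _ /=.
    by rewrite linearZ /= map_polyXn scalerA.
  rewrite triangle_sum; apply: eq_bigr => j _; rewrite scaler_suml.
  apply: eq_bigr => k _; have ltk := ltn_ord k; have ltj := ltn_ord j.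
  rewrite /G (_ : n - (j - 2 * k) - 2 * k = n - j)%N; last by lia.
  congr (_ * _ * _ *: _).
  by rewrite -[LHS]signr_odd -[RHS]signr_odd oddB ?mul2n ?odd_double ?addbF //; lia.
rewrite mulr_sumr; apply: eq_bigr => k _; have ltk := ltn_ord k.
rewrite -mulrA signrMK ezE; last by lia.
by rewrite mulr_algr; congr ((_ * tau K _ _) *: _); lia.
Qed.

(** The points u, z_1, ..., z_n, as elements of the ring of polynomials in u. *)
Let extended_point (j : 'I_n.+1) : {poly A} := if unlift ord0 j is Some j' then ('X_j')%:P else 'X.

(** The cofactor of T_(n-i)(u) in the column of u is (-1)^i times the minor with the row
    of degree n - i omitted, because [lift i] skips exactly the index i.  The linear
    independence of the T_k then compares these cofactors with [prod_subX_chebT]. *)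
Lemma vandermonde_ez m : (m <= n)%N ->
  \det (cheb_mx K n m) = vandermonde_prod K n * ez K n m.
Proof.
move=> le_m; rewrite ezE; last by lia.
pose TT k := map_poly (@polyC A) (T k).
have monT : monic_sequence (fun k => T k).
  exact/(monic_sequence_map (in_alg A))/chebT_monic_monic.
have monTT : monic_sequence TT by apply: monic_sequence_map.
pose y := extended_point.
have := det_monic_sequence y monTT; set M := \matrix_(i, j) _.
rewrite (expand_det_col _ ord0) big_ord_recl /=.
have y0 : y ord0 = 'X by rewrite /y /extended_point unlift_none.
have yS j : y (lift ord0 j) = ('X_j)%:P by rewrite /y /extended_point liftK.
have -> : \prod_(j < n.+1 | (0 < j)%N) (y ord0 - y j) = \prod_(j < n) ('X - ('X_j : A)%:P).
  rewrite big_mkcond big_ord_recl /= mul1r; apply: eq_bigr => j _.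
  by rewrite y0 yS.
have -> : \prod_(i < n) \prod_(j < n.+1 | (bump 0 i < j)%N) (y (lift ord0 i) - y j) =
   (vandermonde_prod K n)%:P.
  rewrite /vandermonde_prod rmorph_prod; apply: eq_bigr => i _.
  rewrite rmorph_prod big_mkcond big_ord_recl /= mul1r [RHS]big_mkcond.
  by apply: eq_bigr => j _; rewrite !yS polyCB.
have minor i : row' i (col' ord0 M) = map_mx (@polyC A) (cheb_mx K n i).
  apply/matrixP => k j; rewrite !mxE /= yS horner_map /=.
  by rewrite (_ : n - bump i k = if (k < i)%N then n - k else n - k - 1)%N // /bump;
    case: ltnP; lia.
have cofE (i : 'I_n.+1) : M i ord0 * cofactor M i ord0 =
    ((-1) ^+ i * \det (cheb_mx K n i)) *: T (n - i)%N.
  rewrite /cofactor minor det_map_mx mxE y0 addn0.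
  have -> : (TT (n - i)%N).['X] = T (n - i)%N by exact: comp_polyXr.
  by rewrite mulrC -mul_polyC polyCM rmorphXn rmorphN1.
rewrite (eq_bigr _ (fun i _ => cofE i)) prod_subX_chebT mulr_suml => E.
apply: (can_inj (signrMK m)).
apply: (monic_sequence_free (p := fun k => T k) (c := fun m => (-1) ^+ m * \det (cheb_mx K n m))
   (d := fun m => (-1) ^+ m * (vandermonde_prod K n * ez_expansion m))) le_m => //.
rewrite E; apply: eq_bigr => k _.
rewrite mulrC mul_polyC scalerA; congr (_ *: _).
by rewrite mulrCA.
Qed.

Lemma vandermonde_prod_neq0 : vandermonde_prod K n != 0.
Proof.
apply/prodf_neq0 => j _; apply/prodf_neq0 => k lt_jk.
rewrite subr_eq0; apply/eqP => /(congr1 (mcoeff U_(j)%MM)) /eqP.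
by rewrite !mcoeffX eqxx eq_mnm1; case: (eqVneq k j) lt_jk => [->|_ _]; rewrite ?ltnn ?oner_eq0.
Qed.
End Phi.

Theorem theorem1p4 (R : realType) (n : nat) (hn : (1 <= n)%N) :
  (forall m : nat, (m <= 2 * n)%N ->
     ez R[i] n m =
       \sum_((maxn 0 (m - n))%N <= k < (m./2).+1)
          'C((n + 2 * k - m)%N, k)%:R *: mesym n R[i] (m - 2 * k)%N) /\
  (forall m : nat, (m <= n)%N ->
     [/\ ez R[i] n m = oz R[i] n (nseq m 1%N),
         tofrac (ez R[i] n m) =
           (tofrac (vandermonde_prod R[i] n))^-1
             * tofrac (\det (cheb_mx R[i] n m)),
         ez R[i] n m =
           \sum_(0 <= k < (m./2).+1) spz R[i] n (nseq (m - 2 * k)%N 1%N)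
       & mesym n R[i] m =
           \sum_(0 <= k < (m./2).+1)
              ((-1) ^+ k * tau R[i] (n - m + 2 * k)%N k) *: ez R[i] n (m - 2 * k)%N]).
Proof.
split=> [m le_m|m le_m]; first by rewrite ezE //; lia.
split.
- by rewrite oz_column.
- rewrite vandermonde_ez // rmorphM /= mulKf //.
  by rewrite tofrac_eq0 vandermonde_prod_neq0.
- exact: ez_sum_spz.
exact: mesym_sum_ez.
Qed.
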